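(* For every finite simple graph $G$, every edge $e\in E(G)$, and every integer $\ell$ with $0\le \ell\le |V(G)|$, \[ -2\le Z^+_{(\ell)}(G)-Z^+_{(\ell)}(G-e)\le 2 . \] Moreover, for every integer $\ell\ge 1$ both constants are attained: (i) there exist a connected finite simple graph $G$ and an edge $e\in E(G)$ with $\ell\le|V(G)|$ and $Z^+_{(\ell)}(G)-Z^+_{(\ell)}(G-e)=-2$; (ii) there exist a finite simple graph $G$ and an edge $e\in E(G)$ with $\ell\le|V(G)|$ such that both $G$ and $G-e$ are connected and $Z^+_{(\ell)}(G)-Z^+_{(\ell)}(G-e)=2$; for $\ell\ge 2$ these graphs may be chosen to have exactly $2\ell+3$ vertices.
   Context: All graphs are finite and simple. $G-e$ is the graph obtained from $G$ by deleting the edge $e$ (keeping all vertices). PSD color-change rule on a graph $X$: let $B\subseteq V(X)$ be the current set of blue vertices (all others are white), and let $C$ be the vertex set of a connected component of $X-B$. A blue vertex $x\in B$ may PSD-force a vertex $y\in C$ (turn $y$ blue) when $N_X(x)\cap C=\{y\}$. Forces are applied one after another, recomputing the components of the white graph after each force. A leak is a vertex that is forbidden to perform a force. A set $B\subseteq V(X)$ is an $\ell$-leaky PSD forcing set of $X$ if, for every set $L\subseteq V(X)$ of exactly $\ell$ leaks, starting from the initial blue set $B$ there is a sequence of PSD forces, none performed by a vertex of $L$, after which all vertices of $X$ are blue. $Z^+_{(\ell)}(X)$ denotes the minimum size of an $\ell$-leaky PSD forcing set of $X$, where $0\le\ell\le|V(X)|$. *)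

(* Defs.v *)
From mathcomp Require Import all_boot.

Set Implicit Arguments.
Unset Strict Implicit.
Unset Printing Implicit Defensive.

Record sgraph := SGraph {
  vertex :> finType;
  adj : rel vertex;
  adj_sym : symmetric adj;
  adj_irrefl : irreflexive adj }.

Definition edges (G : sgraph) : {set {set G}} :=
  [set [set u.1; u.2] | u : G * G & adj u.1 u.2].

Definition connected (G : sgraph) : bool :=
  (0 < #|G|) && [forall x : G, forall y : G, connect (@adj G) x y].

Section DeleteEdge.
Variables (G : sgraph) (e : {set G}).

Definition del_adj : rel G := [rel x y | adj x y && ([set x; y] != e)].

Lemma del_adj_sym : symmetric del_adj.
Proof. by move=> x y; rewrite /del_adj /= adj_sym setUC. Qed.

Lemma del_adj_irrefl : irreflexive del_adj.
Proof. by move=> x; rewrite /del_adj /= adj_irrefl. Qed.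

Definition del_edge : sgraph := SGraph del_adj_sym del_adj_irrefl.

End DeleteEdge.

Arguments del_edge : clear implicits.

Section PSDForcing.
Variable G : sgraph.
Implicit Types (B C L : {set G}) (x y : G) (l : nat).

Definition neighbors x : {set G} := [set y | adj x y].

Definition induced_adj (W : {set G}) : rel G :=
  [rel x y | [&& x \in W, y \in W & adj x y]].

(* Vertex sets of the connected components of G - B. *)
Definition white_components B : {set {set G}} :=
  equivalence_partition (connect (induced_adj (~: B))) (~: B).

Definition psd_force B x y : bool :=
  (x \in B) && [exists C in white_components B, neighbors x :&: C == [set y]].

(* One force, performed by a vertex outside the set L of leaks. *)
Definition psd_step L : rel {set G} :=
  [rel B B' | [exists x, exists y,
    [&& x \notin L, psd_force B x y & B' == y |: B]]].

Definition leaky_psd_forcing l B : bool :=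
  [forall L : {set G}, (#|L| == l) ==> connect (psd_step L) B [set: G]].

(* The full vertex set is always a forcing set (leaky_psd_forcingT), so the
   minimum ranges over a nonempty family; see Zplus_min. *)
Definition Zplus l : nat :=
  #|[arg min_(B < [set: G] | leaky_psd_forcing l B) #|B| ]|.

Lemma leaky_psd_forcingT l : leaky_psd_forcing l [set: G].
Proof. by apply/forallP => L; rewrite connect0 implybT. Qed.

Lemma Zplus_min l :
  (exists2 B, leaky_psd_forcing l B & #|B| = Zplus l) /\
  (forall B, leaky_psd_forcing l B -> Zplus l <= #|B|).
Proof.
rewrite /Zplus; case: arg_minnP => [|B lB minB]; first exact: leaky_psd_forcingT.
by split; first exists B.
Qed.

End PSDForcing.

(* Main.v *)
Require Import Defs.
From mathcomp Require Import all_boot all_order all_algebra.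
From mathcomp Require Import zify.

(* For l <= |V(G)|, a set B is l-leaky forcing iff every nonempty white set W
   disjoint from B admits at least l + 1 vertices able to force; so l-leaky
   forcing sets must hit every "l-fort", a nonempty W with at most l forcers
   when exactly W is white. Once both ends of e are blue, G and G - e admit the
   same forces, whence the bound 2.
   (i) The double star with l leaves at each centre, e joining the centres:
   deleting e brings all degrees down to at most l.
   (ii) For l >= 2, the complete graph K_(l+2) with pendant vertices, one at u,
   one at v and l - 1 at a third vertex w, and e = uv. In G every leaf and every
   pair of clique vertices is an l-fort, so all but one vertex must be blue; in
   G - e the vertices u, v, w may be white.
   For l = 1, a graph on 10 vertices with 6 disjoint 1-forts in which, after the
   deletion of e, the 4 leaves form a forcing set. *)

Set Implicit Arguments.
Unset Strict Implicit.
Unset Printing Implicit Defensive.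

(** * Two facts on finite sets *)

Lemma set2_eq (T : finType) (a b c d : T) :
  ([set a; b] == [set c; d]) = (a == c) && (b == d) || (a == d) && (b == c).
Proof.
apply/eqP/orP => [E|[] /andP[/eqP-> /eqP->]] //; last exact: setUC.
have: (a \in [set c; d]) && (b \in [set c; d]) by rewrite -E set21 set22.
have: (c \in [set a; b]) && (d \in [set a; b]) by rewrite E set21 set22.
rewrite !inE => + /andP[/orP[]/eqP ac /orP[]/eqP bc].
all: rewrite ac bc ?orbb (eq_sym d c) ?andbb !eqxx ?andbT; auto.
all: by case/andP => _ /eqP->; rewrite eqxx; left.
Qed.

(** Pads a set of at most [l] forcers to a leak set of size exactly [l]; this is where [l <= #|G|]
    enters. *)
Lemma subset_card_between (T : finType) (A : {set T}) n :
  #|A| <= n <= #|T| -> exists2 B : {set T}, A \subset B & #|B| = n.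
Proof.
case/andP=> leAn lenT.
have: n - #|A| <= #|~: A| by rewrite leq_subLR cardsC.
case/card_geqP => s [us ss sA].
exists (A :|: [set x in s]); first exact: subsetUl.
rewrite cardsU (_ : _ :&: _ = set0) ?cards0 ?subn0.
  by rewrite cardsE (card_uniqP us) ss subnKC.
apply/setP => x; rewrite !inE; apply/negP => /andP[xA /sA].
by rewrite inE xA.
Qed.

(** * Forcers of a white set, and leaky forcing in terms of them *)

Section Forcers.
Variable G : sgraph.
Implicit Types (B S D W L : {set G}) (x y z : G) (l : nat).

(** The component in which [x] forces [y] contains [y], so it can be described as the set of white
    vertices connected to [y]. *)
Lemma psd_forceP B x y :
  reflect [/\ x \in B, y \notin B, adj x y &
             forall z, z \notin B -> adj x z ->
               connect (induced_adj (~: B)) y z -> z = y]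
          (psd_force B x y).
Proof.
apply: (iffP andP) => [[xB /exists_inP[C /imsetP[a aB ->]]]|[xB yB xy uniq_y]].
  move=> /eqP Neq; have: y \in [set y] by rewrite inE.
  rewrite -Neq !inE => /and3P[xy yB ay]; split=> // z zB xz yz.
  by apply/set1P; rewrite -Neq !inE xz zB (connect_trans ay yz).
split=> //; apply/exists_inP.
exists [set z in ~: B | connect (induced_adj (~: B)) y z].
  by apply/imsetP; exists y; rewrite ?inE.
apply/eqP/setP => z; rewrite !inE.
apply/and3P/eqP => [[xz zB yz]|->]; first exact: uniq_y.
by rewrite connect0.
Qed.

(** The argument is the white set, and leaks are not excluded: they are compared with this set
    afterwards. *)
Definition forcers W : {set G} := [set x | [exists y, psd_force (~: W) x y]].

Lemma forcersP W x :
  reflect (exists y, psd_force (~: W) x y) (x \in forcers W).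
Proof. by rewrite inE; apply: existsP. Qed.

(** More blue vertices only shrink the white component of [y], so [y] remains the unique neighbour
    of [x] there. *)
Lemma psd_forceS B S x y :
  B \subset S -> y \notin S -> psd_force B x y -> psd_force S x y.
Proof.
move=> /subsetP sBS yS /psd_forceP[xB _ xy uniq_y].
apply/psd_forceP; split=> // [|z zS xz yz]; first exact: sBS.
apply: uniq_y => //; first by apply: contra zS => /sBS.
apply: connect_sub yz => a b /and3P[]; rewrite !inE => aS bS ab.
apply: connect1; rewrite /induced_adj /= !inE ab andbT.
by apply/andP; split; [apply: contra aS | apply: contra bS] => /sBS.
Qed.

(** The [l] leaks cannot cover more than [l] forcers, so some other vertex forces. The white set
    loses one vertex and stays disjoint from [B], whence the induction on a bound for its size. *)
Lemma leaky_psd_forcingI l B :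
  (forall W, W != set0 -> [disjoint B & W] -> l < #|forcers W|) ->
  leaky_psd_forcing l B.
Proof.
move=> fW; apply/forallP => L; apply/implyP => /eqP cardL.
suff conS n W : #|W| <= n -> [disjoint B & W] ->
    connect (psd_step L) (~: W) setT.
  by rewrite -[B]setCK (conS #|~: B|) // -subsets_disjoint.
elim: n W => [|n IHn] W leWn dBW.
  by move: leWn; rewrite leqn0 cards_eq0 => /eqP->; rewrite setC0.
have [->|W0] := eqVneq W set0; first by rewrite setC0.
have /subsetPn[x /forcersP[y xy] xL] : ~~ (forcers W \subset L).
  apply: contraTN (fW W W0 dBW) => /subset_leq_card.
  by rewrite cardL -leqNgt.
have [_ yW _ _] := psd_forceP _ _ _ xy.
apply: (@connect_trans _ _ (y |: ~: W)).
  apply: connect1; apply/existsP; exists x; apply/existsP; exists y.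
  by rewrite xL xy eqxx.
rewrite -[y |: _]setCK setCU setCK setIC -setDE.
apply: IHn; last by apply: disjointWr dBW; apply: subD1set.
by rewrite inE negbK in yW; rewrite (cardsD1 y W) yW in leWn.
Qed.

(** Otherwise make every forcer of [W] a leak. A force on a vertex of [W] made while all of [W] is
    still white remains possible when exactly [W] is white, so its author is a leak; hence [W] stays
    white along the whole path. *)
Lemma leaky_forcers l B W :
  l <= #|G| -> leaky_psd_forcing l B -> W != set0 -> [disjoint B & W] ->
  l < #|forcers W|.
Proof.
move=> lG /forallP lB W0 dBW; rewrite ltnNge; apply/negP => leFl.
have [|L /subsetP sFL cardL] := @subset_card_between _ (forcers W) l.
  by rewrite leFl.
move: (lB L); rewrite cardL eqxx => /connectP[p].
have: B \subset ~: W by rewrite -disjoints_subset.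
elim: p B {lB dBW} => [|B' p IHp] B sBW /=.
  by move=> _ BT; rewrite -BT -setC0 setCS subset0 (negPf W0) in sBW.
case/andP=> /existsP[x /existsP[y /and3P[xL xy /eqP->]]] pathp lastp.
apply: IHp pathp lastp; rewrite subUset sBW andbT sub1set.
apply: contraR xL => yW; apply: sFL; apply/forcersP; exists y.
exact: psd_forceS xy.
Qed.

Lemma leaky_psd_forcing_fort l B W :
  l <= #|G| -> leaky_psd_forcing l B -> W != set0 -> #|forcers W| <= l ->
  exists2 x, x \in B & x \in W.
Proof.
move=> lG lB W0 fW; have [dBW|] := boolP [disjoint B & W].
  by have := leaky_forcers lG lB W0 dBW; rewrite ltnNge fW.
by case/pred0Pn => x /andP[]; exists x.
Qed.

(** Immediate from the criterion by forcers: a white set that avoids [S] also avoids [B]. *)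
Lemma leaky_psd_forcingS l B S :
  l <= #|G| -> B \subset S -> leaky_psd_forcing l B -> leaky_psd_forcing l S.
Proof.
move=> lG sBS lB; apply: leaky_psd_forcingI => W W0 dSW.
exact: leaky_forcers lG lB W0 (disjointWl sBS dSW).
Qed.

Lemma forcers_fort1 x : forcers [set x] \subset neighbors x.
Proof.
apply/subsetP => y /forcersP[z /psd_forceP[_]]; rewrite !inE negbK adj_sym.
by move=> /eqP->.
Qed.

Lemma leaky_psd_forcing_deg l B x :
  l <= #|G| -> leaky_psd_forcing l B -> #|neighbors x| <= l -> x \in B.
Proof.
move=> lG lB degx.
have [||y yB /set1P <-//] := leaky_psd_forcing_fort (W := [set x]) lG lB.
  by apply/set0Pn; exists x; rewrite inE.
exact: leq_trans (subset_leq_card (forcers_fort1 x)) degx.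
Qed.

(** Adjacent white vertices share a component, so a blue vertex adjacent to both can force
    neither. *)
Lemma forcers_fort2 p q x : adj p q -> x \in forcers [set p; q] ->
  [/\ x != p, x != q & adj x p != adj x q].
Proof.
move=> pq /forcersP[y /psd_forceP[]]; rewrite !inE negbK.
have pNq : p != q by apply: contraTneq pq => ->; rewrite adj_irrefl.
rewrite negb_or => /andP[xp xq] yW xy uniq_y; split=> //.
apply/eqP => xpq; case/orP: yW => /eqP yE; move: xy uniq_y; rewrite yE => xy.
  move/(_ q); rewrite !inE eqxx orbT -xpq => /(_ isT xy).
  rewrite connect1 => [/(_ isT) E|]; first by rewrite E eqxx in pNq.
  by rewrite /induced_adj /= !inE !eqxx orbT.
move/(_ p); rewrite !inE eqxx xpq => /(_ isT xy).
rewrite connect1 => [/(_ isT) E|]; first by rewrite E eqxx in pNq.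
by rewrite /induced_adj /= !inE !eqxx orbT adj_sym.
Qed.

(* The hypothesis on [D] says that it is a union of components of [W]. *)
Lemma mem_forcers W D x y :
  D \subset W -> (forall a b, a \in D -> b \in W -> adj a b -> b \in D) ->
  x \notin D -> y \in D -> adj x y ->
  (forall z, z \in D -> adj x z -> z = y) -> x \in forcers W.
Proof.
move=> /subsetP sDW closedD xD yD xy uniq_y; apply/forcersP; exists y.
have yW := sDW _ yD.
apply/psd_forceP; rewrite !inE negbK yW; split=> // [|z _ xz yz].
  by apply: contra xD => xW; apply: closedD yD xW _; rewrite adj_sym.
apply: uniq_y => //; move/connectP: yz => [p + ->].
elim: p y yD {xy yW xz} => //= a p IHp y yD /andP[/and3P[_]].
rewrite !inE negbK => aW ya; apply: IHp; exact: (closedD y).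
Qed.

Lemma connected_root r :
  (forall x, connect (@adj G) x r) -> connected G.
Proof.
move=> conr; rewrite /connected; apply/andP; split.
  by apply/card_gt0P; exists r.
apply/forallP => x; apply/forallP => y; apply: connect_trans (conr x) _.
by rewrite (sym_connect_sym (@adj_sym G)).
Qed.

Lemma Zplus_geq l n :
  (forall B, leaky_psd_forcing l B -> n <= #|B|) -> n <= Zplus G l.
Proof. by have [[B lB <-] _] := Zplus_min G l => /(_ B lB). Qed.

Lemma Zplus_leq l n B :
  leaky_psd_forcing l B -> #|B| <= n -> Zplus G l <= n.
Proof.
by move=> lB; apply: leq_trans; have [_] := Zplus_min G l; apply.
Qed.

End Forcers.

(** * The bound 2 for the deletion of an edge *)

Section Delete.
Variables (G : sgraph) (u v : G) (l : nat).
Hypothesis lG : l <= #|G|.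
Let H := del_edge G [set u; v].

(** A white set avoids both ends of the deleted edge, so adjacency to a white vertex, and with it
    white connectivity, is the same in both graphs. *)
Lemma leaky_psd_forcing_del_edge (B : {set G}) : u \in B -> v \in B ->
  @leaky_psd_forcing G l B = @leaky_psd_forcing H l B.
Proof.
move=> uB vB.
have fE (W : {set G}) : [disjoint B & W] -> @forcers G W = @forcers H W.
  move=> dBW; have [uW vW] := (disjointFr dBW uB, disjointFr dBW vB).
  have adjE (a b : G) : b \in W -> @adj H a b = @adj G a b.
    move=> bW; rewrite /= /del_adj /= set2_eq.
    have /negPf-> : b != v by apply: contraTneq bW => ->; rewrite vW.
    have /negPf-> : b != u by apply: contraTneq bW => ->; rewrite uW.
    by rewrite !andbF andbT.
  have conE : connect (@induced_adj H (~: ~: W)) =2 connect (@induced_adj G (~: ~: W)).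
    apply: eq_connect => a b; rewrite /induced_adj /= !setCK.
    by case bW: (b \in W); rewrite ?andbF // -adjE.
  have forceE x y : @psd_force G (~: W) x y = @psd_force H (~: W) x y.
    apply/(@psd_forceP G)/(@psd_forceP H) => -[xW yW xy uniq_y].
      have yW' : y \in W by rewrite inE negbK in yW.
      split=> //; first by rewrite adjE.
      by move=> z zW; rewrite adjE ?conE; [exact: uniq_y | rewrite inE negbK in zW].
    have yW' : y \in W by rewrite inE negbK in yW.
    split=> //; first by rewrite -adjE.
    by move=> z zW; rewrite -adjE -?conE; [exact: uniq_y | rewrite inE negbK in zW].
  apply/setP => x; rewrite !inE.
  by apply/existsP/existsP => -[y]; exists y; rewrite ?forceE // -forceE.
apply/idP/idP => lB; apply: leaky_psd_forcingI => W W0 dBW.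
  rewrite -fE //; exact: (leaky_forcers (G := G) (B := B)).
rewrite fE //; exact: (leaky_forcers (G := H) (B := B)).
Qed.

(** Adding [u] and [v] to an optimal set of either graph gives a forcing set of the other. *)
Lemma Zplus_del_edge_bound :
  (Zplus H l <= Zplus G l + 2) /\ (Zplus G l <= Zplus H l + 2).
Proof.
have cardU (B : {set G}) : #|[set u; v] :|: B| <= #|B| + 2.
  rewrite addnC (leq_trans (leq_card_setU _ _)) // leq_add2r cards2.
  by case: (u == v).
have [uU vU] : (forall B : {set G}, u \in [set u; v] :|: B) /\
               (forall B : {set G}, v \in [set u; v] :|: B).
  by split=> B; rewrite !inE eqxx ?orbT.
split.
  have [[B lB <-] _] := Zplus_min G l.
  apply: (Zplus_leq (B := [set u; v] :|: B : {set H})); last exact: cardU.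
  rewrite -leaky_psd_forcing_del_edge //.
  by apply: leaky_psd_forcingS lB; rewrite ?subsetUr.
have [[B lB <-] _] := Zplus_min H l.
apply: (Zplus_leq (B := [set u; v] :|: B : {set G})); last exact: cardU.
rewrite leaky_psd_forcing_del_edge //.
by apply: leaky_psd_forcingS lB; rewrite ?subsetUr.
Qed.
End Delete.

(** * Complete graphs with pendant vertices, the common shape of the next two examples *)

Section PendantClique.
Variables (K L : finType) (p : L -> K).

Definition pendant_adj : rel (K + L) := fun x y =>
  match x, y with
  | inl i, inl j => i != j
  | inl i, inr k | inr k, inl i => p k == i
  | inr _, inr _ => false
  end.

Lemma pendant_adj_sym : symmetric pendant_adj.
Proof. by case=> [i|k] [j|m] //=; rewrite eq_sym. Qed.

Lemma pendant_adj_irrefl : irreflexive pendant_adj.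
Proof. by case=> [i|k] //=; rewrite eqxx. Qed.

Definition pendant_clique := SGraph pendant_adj_sym pendant_adj_irrefl.

End PendantClique.

(** Counts forcers from below: a short explicit list, plus an injective family that avoids it. *)
Lemma card_cat_codom (I T : finType) (f : I -> T) (s : seq T) (A : {set T}) :
  injective f -> uniq s -> {subset s <= A} ->
  (forall i, (f i \in A) && (f i \notin s)) -> size s + #|I| <= #|A|.
Proof.
move=> injf us sA fA; apply/card_geqP; exists (s ++ codom f); split.
- rewrite cat_uniq us map_inj_uniq ?enum_uniq // andbT.
  by apply/hasPn => _ /codomP[i ->]; have /andP[] := fA i.
- by rewrite size_cat size_codom.
- by move=> x; rewrite mem_cat => /orP[/sA|/codomP[i ->]] //; have /andP[] := fA i.
Qed.

(** * The double star, where deletion raises the parameter by 2 *)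

Section DoubleStar.
Variable l : nat.
Hypothesis l_gt0 : 0 < l.

Definition double_star := pendant_clique (fst : bool * 'I_l -> bool).
Let G : sgraph := double_star.
Let center b : G := inl b.
Let leaf b k : G := inr (b, k).
Let e : {set G} := [set center true; center false].

Lemma double_star_connected : connected G.
Proof.
apply: (connected_root (r := center true)).
have conC b : connect (@adj G) (center b) (center true).
  by case: b; [exact: connect0 | exact: connect1].
by case=> [b|[b k]]; first exact: conC;
  apply: connect_trans (conC b); apply/connect1/eqxx.
Qed.

(** The leaves form a forcing set. A white centre is forced by each of its [l] leaves; one further
    forcer is a leaf of the other centre if that is white too, and the other centre itself if it is
    blue. *)
Lemma double_star_Zplus : Zplus G l <= 2 * l.
Proof.
pose B : {set G} := [set x | if x is inr _ then true else false].
apply: (Zplus_leq (B := B)).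
  apply: leaky_psd_forcingI => W W0 dBW.
  have WC x : x \in W -> exists b, x = center b.
    by case: x => [b|k] xW; [exists b | have := disjointFl dBW xW; rewrite inE].
  case/set0Pn: W0 => y yW; have [b yE] := WC y yW; rewrite {y}yE in yW.
  have leafF b' k : center b' \in W -> leaf b' k \in forcers W.
    move=> bW; apply: (mem_forcers (D := W) (y := center b')) => //=.
    - by apply/negP => /WC[].
    - by move=> z /WC[b'' ->] /= /eqP->.
  rewrite -[X in X < _]card_ord.
  have [cW|cW] := boolP (center (~~ b) \in W).
    apply: (card_cat_codom (f := leaf b) (s := [:: leaf (~~ b) (Ordinal l_gt0)])) => //.
    - by move=> k m [].
    - by move=> x; rewrite mem_seq1 => /eqP->; apply: leafF.
    - by move=> k; rewrite leafF // mem_seq1; apply/eqP => -[]; case: b {yW cW}.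
  apply: (card_cat_codom (f := leaf b) (s := [:: center (~~ b)])) => //.
  - by move=> k m [].
  - move=> x; rewrite mem_seq1 => /eqP->.
    apply: (mem_forcers (D := W) (y := center b)) => //=; first by case: b {yW cW}.
    by move=> z zW; have [b' zE] := WC z zW; move: cW zW; rewrite {z}zE /center;
      case: b b' {yW} => [] [] //= /negPf->.
  - by move=> k; rewrite leafF.
have -> : B = [set inr k | k in setT].
  apply/setP => -[b|k]; rewrite inE; first by apply/esym/negbTE/imsetP => -[].
  by apply/esym/imsetP; exists k.
by rewrite (leq_trans (leq_imset_card _ _)) // cardsT card_prod card_bool card_ord.
Qed.

Lemma double_star_del_Zplus : 2 * l + 2 <= Zplus (del_edge G e) l.
Proof.
have cardG : #|del_edge G e| = 2 * l + 2.
  by rewrite card_sum card_prod !card_bool card_ord addnC.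
apply: Zplus_geq => B lB.
suff -> : B = setT by rewrite cardsT cardG.
apply/setP => x; rewrite inE.
apply: leaky_psd_forcing_deg lB _; first by rewrite cardG; lia.
case: x => [b|[b k]].
  apply: (@leq_trans #|[set leaf b k | k in setT]|).
    apply/subset_leq_card/subsetP => -[b'|[b' k]]; rewrite inE /= /del_adj /=.
      by rewrite /e set2_eq; case: b b' => [] [].
    by move=> /andP[/eqP-> _]; apply/imsetP; exists k.
  by rewrite (leq_trans (leq_imset_card _ _)) // cardsT card_ord.
apply: (@leq_trans #|[set center b]|); last by rewrite cards1.
apply/subset_leq_card/subsetP => -[b'|[b' k']]; rewrite inE /= /del_adj //=.
by move=> /andP[/eqP-> _]; rewrite inE.
Qed.

Lemma double_star_edge : e \in edges G.
Proof. by apply/imsetP; exists (center true, center false); rewrite ?inE. Qed.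

End DoubleStar.

(** * The clique with pendants at three vertices, for [l >= 2] *)

(* Here [r] is l - 1. *)
Section Triple.
Variable r : nat.

(** Among the clique vertices, [inl b] are the ends of [e] with one leaf each, [inr None] is [w]
    with [r] leaves, and the [r] vertices [inr (Some i)] have none. *)
Definition triple_parent (x : bool + 'I_r) : bool + option 'I_r :=
  if x is inl b then inl b else inr None.

Definition triple_clique := pendant_clique triple_parent.
Let G : sgraph := triple_clique.
Let c b : G := inl (inl b).
Let w : G := inl (inr None).
Let d i : G := inl (inr (Some i)).
Let leaf b : G := inr (inl b).
Let wleaf i : G := inr (inr i).
Let e : {set G} := [set c true; c false].
Let H := del_edge G e.

Lemma card_triple_clique : #|G| = 2 * r.+1 + 3.
Proof. by rewrite !card_sum card_option !card_bool card_ord; lia. Qed.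

Lemma triple_clique_del_connected : connected H.
Proof.
have conC i : connect (@adj H) (inl i) w.
  case: i => [b|[i|]]; last exact: connect0.
    by apply: connect1; rewrite /= /del_adj /= /e set2_eq; case: b.
  by apply: connect1; rewrite /= /del_adj /= /e set2_eq.
apply: (connected_root (G := H) (r := w)); case=> [i|k]; first exact: conC.
apply: connect_trans (conC (triple_parent k)); apply: connect1.
by rewrite /= /del_adj /= eqxx /e set2_eq.
Qed.

Lemma triple_clique_connected : connected G.
Proof.
have /andP[_ /forallP conH] := triple_clique_del_connected.
apply: (connected_root (r := w)) => x; have /forallP/(_ w) := conH x.
by apply: connect_sub => a b /andP[ab _]; apply: connect1.
Qed.

Lemma triple_clique_edge : e \in edges G.
Proof. by apply/imsetP; exists (c true, c false); rewrite ?inE. Qed.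

(** Any other clique vertex sees both members of a clique pair, so only leaves can force into the
    pair. *)
Lemma triple_clique_Zplus : 0 < r -> 2 * r.+1 + 2 <= Zplus G r.+1.
Proof.
move=> r_gt0; apply: Zplus_geq => B lB.
have lG : r.+1 <= #|G| by rewrite card_triple_clique; lia.
have leafB k : inr k \in B.
  apply: leaky_psd_forcing_deg lG lB _.
  apply: (@leq_trans #|[set (inl (triple_parent k) : G)]|); last by rewrite cards1.
  by apply/subset_leq_card/subsetP => -[i|m]; rewrite !inE //= => /eqP->.
have pairB i j : i != j -> (inl i \in B) || (inl j \in B).
  move=> ij; pose W : {set G} := [set inl i; inl j].
  suff fW : #|forcers W| <= r.+1.
    have [|x xB] := leaky_psd_forcing_fort lG lB _ fW.
      by apply/set0Pn; exists (inl i); rewrite !inE eqxx.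
    by rewrite !inE => /orP[] /eqP <-; rewrite xB ?orbT.
  pose A := [set k | triple_parent k \in pred2 i j].
  apply: (@leq_trans #|[set (inr k : G) | k in A]|).
    apply/subset_leq_card/subsetP => x /(@forcers_fort2 G (inl i) (inl j) x ij)[].
    case: x => [m|k] /=.
      rewrite !(inj_eq (@inl_inj _ _)) => mi mj.
      by rewrite mi mj.
    move=> _ _ kij; apply: imset_f; rewrite inE /=.
    by apply: contraR kij; rewrite negb_or => /andP[/negPf-> /negPf->].
  rewrite (leq_trans (leq_imset_card _ _)) // -ltnS.
  have <- : #|{: bool + 'I_r}| = r.+2 by rewrite card_sum card_bool card_ord.
  rewrite -cardsT; apply: proper_card; rewrite properT.
  apply/negP => /eqP AT.
  have: [&& triple_parent (inl true) \in pred2 i j,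
            triple_parent (inl false) \in pred2 i j &
            triple_parent (inr (Ordinal r_gt0)) \in pred2 i j].
    have inA k : triple_parent k \in pred2 i j.
      by have := in_setT k; rewrite -AT inE.
    by rewrite !inA.
  by case: i j {ij W A AT} => [[]|[?|]] [[]|[?|]].
have: #|~: B| <= 1.
  apply/card_le1_eqP => x y; rewrite !inE => xB yB.
  case: x xB => [i|k] xB; last by rewrite leafB in xB.
  case: y yB => [j|k] yB; last by rewrite leafB in yB.
  have [->//|ij] := eqVneq i j.
  by have := pairB i j ij; rewrite (negPf xB) (negPf yB).
have := cardsC B; rewrite card_triple_clique; lia.
Qed.

Lemma triple_clique_del_Zplus : Zplus H r.+1 <= 2 * r.+1.
Proof.
pose B : {set H} := ~: (w |: e).
apply: (Zplus_leq (B := B)); last first.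
  have := cardsC (w |: e); rewrite card_triple_clique.
  have -> : #|w |: e| = 3 by rewrite cardsU1 cards2 !inE.
  by move=> cardB; rewrite (_ : #|B| = #|~: (w |: e)|) //; lia.
apply: leaky_psd_forcingI => W W0 dBW.
have WC x : x \in W -> [\/ x = w, x = c true | x = c false].
  move=> xW; have := disjointFl dBW xW; rewrite !inE => /negbFE.
  by case/or3P => /eqP->; [apply: Or31 | apply: Or32 | apply: Or33].
have adjH x y : @adj H x y = @adj G x y && ~~ ((x \in e) && (y \in e)).
  rewrite /= /del_adj /= /e set2_eq !inE.
  by case: x y => [[[]|[?|]]|[[]|?]] [[[]|[?|]]|[[]|?]].
have uniqF x y : x \notin W -> y \in W -> @adj H x y ->
  (forall z, z \in W -> @adj H x z -> z = y) -> x \in @forcers H W.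
  by move=> xW yW xy uniq_y; apply: (mem_forcers (D := W) (y := y)).
have leafW k : inr k \notin W.
  by apply/negP => /WC[].
have leafF k : inl (triple_parent k) \in W -> inr k \in @forcers H W.
  move=> kW; apply: (uniqF _ (inl (triple_parent k))) => //.
    by rewrite adjH /= eqxx !inE.
  by move=> z /WC[]-> /andP[/eqP->].
have cardI x y f : x \in @forcers H W -> y \in @forcers H W ->
    injective f -> uniq [:: x; y] ->
    (forall i : 'I_r, (f i \in @forcers H W) && (f i \notin [:: x; y])) ->
    r.+1 < #|@forcers H W|.
  move=> xF yF injf uxy fF; rewrite -[in X in X < _](card_ord r).
  apply: card_cat_codom injf uxy _ fF => z.
  by rewrite mem_seq2 => /orP[] /eqP->.
(* Each case exhibits two special forcers and a family of [r] more. If [w] and an end of [e] are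
   white, the family consists of the leaves at [w]; otherwise it consists of the vertices [d i]. *)
have [wW|wW] := boolP (w \in W).
  have [b bW|cW] := pickP (fun b => c b \in W).
    have [cW|cW] := boolP (c (~~ b) \in W).
      apply: (cardI (leaf b) (leaf (~~ b)) wleaf).
      - exact: leafF.
      - exact: leafF.
      - by move=> i j [].
      - by case: b {bW cW}.
      - by move=> i; rewrite leafF.
    apply: (cardI (leaf b) (c (~~ b)) wleaf).
    - exact: leafF.
    (* The blue end of [e] is no longer adjacent to the white end, so [w] is its only white
       neighbour. *)
    - apply: (uniqF _ w) => //; first by rewrite adjH !inE; case: (b).
      move=> z zW; case: (WC z zW) (zW) => -> {}zW //; rewrite adjH !inE;
        by case: b bW cW => /= _; rewrite ?zW.
    - by move=> i j [].
    - by case: b {bW cW}.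
    - by move=> i; rewrite leafF.
  have uniq_w z : z \in W -> z = w.
    by move=> zW; case: (WC z zW) (zW) => -> //; rewrite cW.
  apply: (cardI (c true) (c false) d).
  - by apply: (uniqF _ w) => //; [rewrite cW | rewrite adjH !inE | move=> z /uniq_w].
  - by apply: (uniqF _ w) => //; [rewrite cW | rewrite adjH !inE | move=> z /uniq_w].
  - by move=> i j [].
  - by [].
  - move=> i; rewrite andbT.
    by apply: (uniqF _ w) => //;
      [apply/negP => /WC[] | rewrite adjH !inE | move=> z /uniq_w].
have [b bW] : exists b, c b \in W.
  by case/set0Pn: W0 wW => x xW; case: (WC x xW) (xW) => -> {}xW;
    rewrite ?xW //; [exists true | exists false].
(* With [w] blue and [e] deleted, [c b] is a white component by itself, so each blue neighbour
   forces it. *)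
have cF x : x \notin e -> x \notin W -> @adj G x (c b) -> x \in @forcers H W.
  move=> xe xW xc; apply: (mem_forcers (D := [set c b : H]) (y := c b));
    rewrite ?inE ?sub1set //.
  - move=> y z; rewrite !inE => /eqP-> zW.
    case: (WC z zW) (zW) => -> {}zW; rewrite ?zW // in wW *;
      rewrite adjH !inE; by case: b {bW xc}.
  - by apply: contraNneq xe => ->; rewrite !inE; case: b {bW xc}.
  - by rewrite adjH xc (negPf xe).
  - by move=> z /set1P.
apply: (cardI w (leaf b) d) => //.
- by apply: cF => //; rewrite !inE.
- exact: leafF.
- by move=> i j [].
- move=> i; rewrite andbT; apply: cF => //; first by rewrite !inE.
  by apply/negP => /WC[].
Qed.

End Triple.

(** * Graphs given by edge lists, and a computable test for forcers *)

Section EdgeList.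
Variable E : seq (nat * nat).
Hypothesis E_irrefl : all (fun p => p.1 != p.2) E.

Definition edge_rel : rel nat := fun i j => ((i, j) \in E) || ((j, i) \in E).

Variable n : nat.

Lemma edge_list_sym : symmetric (fun i j : 'I_n => edge_rel i j).
Proof. by move=> i j; rewrite /edge_rel orbC. Qed.

Lemma edge_list_irrefl : irreflexive (fun i j : 'I_n => edge_rel i j).
Proof. by move=> i; apply/negP; rewrite /edge_rel orbb => /(allP E_irrefl) /eqP. Qed.

Definition edge_list_graph := SGraph edge_list_sym edge_list_irrefl.
End EdgeList.

Fixpoint subseqs (s : seq nat) : seq (seq nat) :=
  if s is x :: s' then map (cons x) (subseqs s') ++ subseqs s' else [:: [::]].

Lemma filter_subseqs (P : pred nat) s : filter P s \in subseqs s.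
Proof.
elim: s => //= x s IHs; rewrite mem_cat; case: (P x); last by rewrite IHs orbT.
by rewrite map_f.
Qed.

Lemma subseqs_sub s t : t \in subseqs s -> {subset t <= s}.
Proof.
elim: s t => [|x s IHs] t /=; first by rewrite inE => /eqP->.
rewrite mem_cat => /orP[/mapP[t' /IHs sub ->]|/IHs sub] y.
  by rewrite !inE => /orP[->//|/sub->]; rewrite orbT.
by move=> /sub; rewrite inE orbC => ->.
Qed.

Definition unique_nbr (a : rel nat) (D : seq nat) x :=
  (x \notin D) && has (fun y => a x y && all (fun z => a x z ==> (z == y)) D) D.

Definition component_union (a : rel nat) (D W : seq nat) :=
  all (fun p => all (fun q => a p q ==> (q \in D)) W) D.

(** A sufficient test modelled on [mem_forcers]: all forcers counted act into one common union [D]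
    of components of [W]. *)
Definition enough_forcers (a : rel nat) n l W :=
  has (fun D => component_union a D W && (l < count (unique_nbr a D) (iota 0 n)))
      (subseqs W).

(* Deleted edge: {0, 3}. Leaves: 6, 7, 8, 9. The 1-forts hit separately are the
   four leaves, {0, 2} and {1, 3}. *)
Definition ten_edges : seq (nat * nat) :=
  [:: (0, 3); (0, 1); (0, 2); (1, 2); (1, 3); (2, 3); (3, 4); (1, 4); (0, 5); (2, 5);
      (1, 6); (0, 7); (4, 8); (5, 9)].

Lemma ten_edges_irrefl : all (fun p => p.1 != p.2) ten_edges.
Proof. by []. Qed.

Definition ten_graph := edge_list_graph ten_edges_irrefl 10.

(** * The graph on 10 vertices, for [l = 1] *)

Section TenGraph.
Let G : sgraph := ten_graph.
Let o k : G := inord k.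
Let e : {set G} := [set o 0; o 3].
Let H := del_edge G e.
(** The deleted edge heads the list, so [behead] leaves the edges of [H]. *)
Let a : rel nat := edge_rel (behead ten_edges).

Lemma ten_del_adj (x y : 'I_10) : @adj H x y = a x y.
Proof.
rewrite /= /del_adj /= /e set2_eq -!val_eqE /= !inordK // /a /edge_rel.
move: (ltn_ord x) (ltn_ord y).
have: all (fun i => all (fun j => ((edge_rel ten_edges i j) &&
   ~~ ((i == 0) && (j == 3) || (i == 3) && (j == 0)) == a i j)) (iota 0 10)) (iota 0 10).
  by vm_compute.
move=> /allP ch xl yl.
have xi : (x : nat) \in iota 0 10 by rewrite mem_iota.
have yi : (y : nat) \in iota 0 10 by rewrite mem_iota.
by have /allP/(_ _ yi)/eqP := ch _ xi.
Qed.

(** Every nonzero label has a smaller neighbour in [H], so descending labels lead to 0. *)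
Lemma ten_del_connected : connected H.
Proof.
apply: (connected_root (G := H) (r := o 0)) => x.
have [k] := ubnP (val x); elim: k x => // k IHk x; rewrite ltnS => lexk.
have [x0|x_gt0] := posnP (val x).
  by rewrite (_ : x = o 0) ?connect0 //; apply: val_inj; rewrite /= inordK.
have: all (fun i => has (fun j => (j < i) && a i j) (iota 0 10)) (iota 1 9) by vm_compute.
have xi : val x \in iota 1 9 by rewrite mem_iota x_gt0 ltn_ord.
move=> /allP/(_ _ xi)/hasP[j]; rewrite mem_iota /= => jlt /andP[jx xj].
apply: (@connect_trans _ _ (o j)).
  by apply: connect1; rewrite -[is_true _]/(is_true (@adj H x (o j))) ten_del_adj inordK.
by apply: IHk; rewrite /= inordK // (leq_trans jx).
Qed.

Lemma ten_connected : connected G.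
Proof.
have /andP[_ /forallP conH] := ten_del_connected.
apply: (connected_root (r := o 0)) => x; have /forallP/(_ (o 0)) := conH x.
by apply: connect_sub => y z /andP[yz _]; apply: connect1.
Qed.

Lemma ten_edge : e \in edges G.
Proof.
by apply/imsetP; exists (o 0, o 3); rewrite // inE /= !inordK.
Qed.

Lemma ten_Zplus : 6 <= Zplus G 1.
Proof.
apply: Zplus_geq => B lB; have lG : 1 <= #|G| by rewrite card_ord.
have leafB k j : j < 10 -> k < 10 ->
    all (fun i => edge_rel ten_edges k i ==> (i == j)) (iota 0 10) -> o k \in B.
  move=> j10 k10 /allP degk; apply: leaky_psd_forcing_deg lG lB _.
  rewrite -(cards1 (o j)); apply/subset_leq_card/subsetP => i.
  rewrite !inE /= inordK // => ki; have := degk i;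
  rewrite mem_iota /= ltn_ord ki => /(_ isT) /eqP ij.
  by apply/eqP/val_inj; rewrite /= inordK.
have pairB p q m : p < 10 -> q < 10 -> m < 10 -> edge_rel ten_edges p q ->
    all (fun i => [&& i != p, i != q &
           edge_rel ten_edges i p != edge_rel ten_edges i q] ==> (i == m))
      (iota 0 10) -> exists2 x, x \in B & x \in [set o p; o q].
  move=> p10 q10 m10 pq /allP cm; apply: leaky_psd_forcing_fort lG lB _ _.
    by apply/set0Pn; exists (o p); rewrite !inE eqxx.
  rewrite -(cards1 (o m)); apply/subset_leq_card/subsetP => x.
  have pq' : adj (o p) (o q) by rewrite /= !inordK.
  move=> /(forcers_fort2 pq') [xp xq]; rewrite /= !inordK // => xpq.
  rewrite -val_eqE /= inordK // in xp; rewrite -val_eqE /= inordK // in xq.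
  have := cm x; rewrite mem_iota /= ltn_ord xp xq xpq => /(_ isT) /eqP xm.
  by rewrite inE; apply/eqP/val_inj; rewrite /= inordK.
(* The third number is the only possible forcer: leaf 7 at 0, then leaf 6 at 1. The edge {0, 3}
   makes 3 a common neighbour of 0 and 2, and 0 one of 1 and 3. *)
have [x xB xP] := pairB 0 2 7 isT isT isT isT isT.
have [y yB yP] := pairB 1 3 6 isT isT isT isT isT.
apply/card_geqP; exists [:: x; y; o 6; o 7; o 8; o 9]; split=> //.
  move: xP yP; rewrite -(map_inj_uniq val_inj) !inE /= !inordK //.
  by case/orP => /eqP-> /orP[] /eqP->; rewrite /= !inordK.
move=> z; rewrite !inE; case/orP => [/eqP->//|]; case/orP => [/eqP->//|].
case/or4P => /eqP->; [apply: (leafB _ 1) | apply: (leafB _ 0) |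
  apply: (leafB _ 4) | apply: (leafB _ 5)]; by vm_compute.
Qed.

Lemma ten_del_Zplus : Zplus H 1 <= 4.
Proof.
pose B : {set H} := [set x : 'I_10 | 6 <= x].
apply: (Zplus_leq (B := B)); last first.
  apply: (@leq_trans #|[set o (6 + i) | i : 'I_4]|).
    apply/subset_leq_card/subsetP => x; rewrite inE => x_ge6.
    have x_lt10 := ltn_ord x; apply/imsetP; exists (inord (x - 6)) => //.
    by apply: val_inj; rewrite /= !inordK; lia.
  by rewrite (leq_trans (leq_imset_card _ _)) // card_ord.
apply: leaky_psd_forcingI => W W0 dBW.
pose s := [seq i <- iota 0 6 | o i \in W].
have sW (x : 'I_10) : (val x \in s) = (x \in W).
  rewrite mem_filter mem_iota /= add0n /o inord_val.
  have [xW|//] := boolP (_ \in W); have := disjointFl dBW xW.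
  by rewrite inE ltnNge => /negbFE. 
(* All 64 subsets of the non-leaves are tested by computation. *)
have : all (fun t => (t == [::]) || enough_forcers a 10 1 t) (subseqs (iota 0 6)).
  by vm_compute.
move=> /allP/(_ _ (filter_subseqs (fun i => o i \in W) _)) /orP[/eqP s0|].
  by case/set0Pn: W0 => x; rewrite -sW /s s0.
case/hasP => D /subseqs_sub sDs /andP[/allP closedD].
move/leq_trans; apply.
pose Ds : {set H} := [set x : 'I_10 | val x \in D].
(* The count over labels becomes the size of a duplicate-free list of vertices, so it remains to see
   that each listed vertex is a forcer. *)
rewrite -val_enum_ord count_map -size_filter cardE.
apply: uniq_leq_size; first by rewrite filter_uniq // enum_uniq.
move=> x; rewrite mem_filter mem_enum => /andP[/andP[/= xD] + _].
case/hasP=> y yD /andP[xy /allP uniq_y].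
have y10 : y < 10.
  by have := sDs _ yD; rewrite mem_filter mem_iota => /andP[_ /leq_trans]; apply.
have oy : val (o y) = y by rewrite /= inordK.
rewrite mem_enum; apply: (mem_forcers (D := Ds) (y := o y)).
- by apply/subsetP => z; rewrite inE -sW => /sDs.
- move=> u v; rewrite !inE ten_del_adj -sW => uD vW uv.
  by have /allP/(_ _ vW) := closedD _ uD; rewrite uv.
- by rewrite inE.
- by rewrite inE oy.
- by rewrite ten_del_adj oy.
- move=> z; rewrite inE ten_del_adj => zD xz; apply: val_inj; rewrite oy.
  by have := uniq_y _ zD; rewrite xz => /eqP.
Qed.

End TenGraph.

Theorem theorem1 :
  (forall (G : sgraph) (e : {set G}) (l : nat),
      e \in edges G -> l <= #|G| ->
      (-2 <= (Zplus G l)%:Z - (Zplus (del_edge G e) l)%:Z <= 2)%R) /\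
  (forall l : nat, 1 <= l ->
    (exists (G : sgraph) (e : {set G}),
        [/\ connected G, e \in edges G, l <= #|G| &
            ((Zplus G l)%:Z - (Zplus (del_edge G e) l)%:Z = -2)%R]) /\
    (exists (G : sgraph) (e : {set G}),
        [/\ e \in edges G, l <= #|G|,
            connected G /\ connected (del_edge G e),
            ((Zplus G l)%:Z - (Zplus (del_edge G e) l)%:Z = 2)%R &
            2 <= l -> #|G| = 2 * l + 3])).
Proof.
split=> [G e l /imsetP[[u v] _ ->] lG | l l_gt0].
  have [/= le1 le2] := Zplus_del_edge_bound u v lG; lia.
split.
  have cardG : l <= #|double_star l|.
    by rewrite card_sum card_prod !card_bool card_ord; lia.
  exists (double_star l), [set inl true; inl false]; split=> //.
  - exact: double_star_connected.
  - exact: double_star_edge.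
  (* The general bound supplies the inequality opposite to the one given by the example, so the
     difference is exact. *)
  have [/= le1 le2] :=
    @Zplus_del_edge_bound (double_star l) (inl true) (inl false) _ cardG.
  have /= := double_star_Zplus l_gt0; have /= := double_star_del_Zplus l_gt0; lia.
have [l_eq1|l_neq1] := eqVneq l 1.
  rewrite {l l_gt0}l_eq1; have cardG : 1 <= #|ten_graph| by rewrite card_ord.
  exists ten_graph, [set inord 0; inord 3]; split=> //.
  - exact: ten_edge.
  - by split; [exact: ten_connected | exact: ten_del_connected].
  have [/= le1 le2] := @Zplus_del_edge_bound (ten_graph) (inord 0) (inord 3) _ cardG.
  have /= := ten_Zplus; have /= := ten_del_Zplus; lia.
(* Here [l] becomes [r.+2], so the parameter of the clique is [r.+1], which is positive as its lower
   bound requires. *)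
case: l l_gt0 l_neq1 => [//|[//|r]] _ _.
have cardG := card_triple_clique r.+1.
exists (triple_clique r.+1), [set inl (inl true); inl (inl false)]; split=> //.
- exact: triple_clique_edge.
- by rewrite cardG; lia.
- by split; [exact: triple_clique_connected | exact: triple_clique_del_connected].
have lG : r.+2 <= #|triple_clique r.+1| by rewrite cardG; lia.
have [/= le1 le2] := @Zplus_del_edge_bound (triple_clique r.+1)
  (inl (inl true)) (inl (inl false)) _ lG.
have /= := triple_clique_Zplus (ltn0Sn r); have /= := triple_clique_del_Zplus r.+1; lia.
Qed.
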